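(* Let $R$ be a $2$-torsion free prime ring with an involution $\ast$ of the second kind. Suppose that $R$ admits nontrivial endomorphisms $g_1, g_2$ satisfying at least one of the following two conditions: (1) $g_1(x)g_2(x^{\ast}) - xx^{\ast} \in Z(R)$ for all $x \in R$; (2) $g_1(x)g_2(x^{\ast}) - x^{\ast}x \in Z(R)$ for all $x \in R$. Then $R$ is commutative.
   Context: $R$ is an associative ring (not assumed to have an identity) and $Z(R)$ is its center. $R$ is prime if $aRb=\{0\}$ implies $a=0$ or $b=0$. $R$ is $2$-torsion free if $2x=0$ with $x\in R$ implies $x=0$. An involution on $R$ is an anti-automorphism $\ast\colon R\to R$ (additive bijection with $(xy)^\ast=y^\ast x^\ast$) satisfying $(x^\ast)^\ast=x$ for all $x\in R$. Let $H(R)=\{x\in R: x^\ast=x\}$ and $S(R)=\{x\in R: x^\ast=-x\}$. The involution is of the first kind if $Z(R)\subseteq H(R)$; otherwise it is of the second kind, in which case $S(R)\cap Z(R)\neq\{0\}$. An endomorphism of $R$ is a ring endomorphism (additive and multiplicative); a nontrivial endomorphism means an endomorphism that is not the identity map on $R$. *)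

(* Defs.v *)
From HB Require Import structures.
From mathcomp Require Import all_boot all_algebra.

Set Implicit Arguments.
Unset Strict Implicit.
Unset Printing Implicit Defensive.

Import GRing.Theory.

Local Open Scope ring_scope.

(* [x * y] is the unital [GRing.mul] in [ring_scope]; the arguments of [+] are
   always parsed there, so the semigroup product needs its own symbol. *)
Notation "x ** y" := (monoid.mul x y)
  (at level 40, left associativity) : ring_scope.

(* Rings without a unit: [pzRingType] and its extensions all
   carry a [1], so the structure is the join of [zmodType] and
   [semigroupType] together with distributivity. *)
HB.mixin Record ZmoduleSemigroup_isRng R of GRing.Zmodule R & Semigroup R := {
  rng_mulDl : forall x y z : R, (x + y) ** z = x ** z + y ** z;
  rng_mulDr : forall x y z : R, x ** (y + z) = x ** y + x ** z
}.

#[short(type="rngType")]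
HB.structure Definition Rng :=
  {R of ZmoduleSemigroup_isRng R & GRing.Zmodule R & Semigroup R}.

Definition central (R : rngType) (z : R) : Prop := forall x : R, commute z x.

Definition prime_rng (R : rngType) : Prop :=
  forall a b : R, (forall x : R, a ** x ** b = 0) -> a = 0 \/ b = 0.

Definition two_torsion_free (R : rngType) : Prop :=
  forall x : R, x *+ 2 = 0 -> x = 0.

Definition anti_automorphism (R : rngType) (star : R -> R) : Prop :=
  [/\ {morph star : x y / x + y},
      forall x y : R, star (x ** y) = star y ** star x
    & bijective star].

Definition rng_involution (R : rngType) (star : R -> R) : Prop :=
  anti_automorphism star /\ involutive star.

Definition hermitian (R : rngType) (star : R -> R) (x : R) : Prop :=
  star x = x.

Definition first_kind (R : rngType) (star : R -> R) : Prop :=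
  forall z : R, central z -> hermitian star z.

Definition second_kind (R : rngType) (star : R -> R) : Prop :=
  ~ first_kind star.

Definition rng_endomorphism (R : rngType) (g : R -> R) : Prop :=
  {morph g : x y / x + y} /\ {morph g : x y / x ** y}.

Definition nontrivial_endomorphism (R : rngType) (g : R -> R) : Prop :=
  rng_endomorphism g /\ ~ (g =1 id).

(* Main.v *)
Require Import Defs.
From mathcomp Require Import all_boot all_algebra.

Set Implicit Arguments.
Unset Strict Implicit.

Import GRing.Theory.

Local Open Scope ring_scope.

(** Only the polarised condition at [x = k] is needed, where [k] is a nonzero
    skew central element; there conditions (1) and (2) coincide. Put
    [p = g1 k] and [q = g2 k]. Then
      [p ** g2 y - g1 y^* ** q - k ** (y - y^* )]
    is central for all [y]. Taking [y = k] makes [c = p ** q] central, and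
    replacing [y] by [k ** y] gives
      [c ** (g2 y + g1 y^* ) = k ** k ** (y + y^* )]
    modulo the center. If [R] is not commutative, then [c] is nonzero and
    [q - p] is central; eliminating [g2 y + g1 y^*] leaves [q = p] and
    [c = k ** k]. As [p] commutes with the images of [g1] and [g2], it commutes
    with [y + y^*] for all [y], so it is central and equals [k] or [- k].
    Accordingly [g2 y] is congruent to [y] or to [y^*] modulo the center. A map
    that is multiplicative (resp. antimultiplicative) and congruent to the
    identity modulo the center of a noncommutative prime ring is the identity:
    the first is excluded by nontriviality of [g2], the second would make [R]
    commutative. *)

(* Cancels opposite summands in an equality of integral combinations. The
   structure of [Algebra.opp] is taken from the goal: re-elaborating [- t0] may
   infer another path, and [context] matches syntactically. *)
Ltac zmod_move t1 :=
  repeat match goal with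
  | |- context [?s0 + t1 + ?t2] =>
      tryif constr_eq t2 t1 then fail else rewrite (addrAC s0 t1 t2)
  | |- context [t1 + ?t2] =>
      tryif constr_eq t2 t1 then fail else rewrite (addrC t1 t2)
  end.
Ltac zmod :=
  apply/eqP; rewrite -subr_eq0; apply/eqP;
  rewrite ?mulr2n ?(opprD, opprB, opprK, oppr0, addr0, add0r) ?addrA;
  repeat (match goal with
  | |- context [@Algebra.opp ?V ?t0] =>
      zmod_move t0; zmod_move (@Algebra.opp V t0);
      rewrite ?(addrNK, addrK, subrr, addNr, add0r, addr0)
  end); try reflexivity.

Lemma additive_opp (V W : zmodType) (f : V -> W) :
  {morph f : x y / x + y} -> {morph f : x / - x}.
Proof.
move=> fD x; apply: (addrI (f x)); rewrite -fD !subrr.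
by apply: (addrI (f 0)); rewrite -fD !addr0.
Qed.

(** * Signs and central elements in rings without unit *)

Section Rng.
Variable R : rngType.
Implicit Types a b c x y z : R.

Lemma rng_mul0l a : 0 ** a = 0.
Proof. by apply: (addrI (0 ** a)); rewrite -rng_mulDl !addr0. Qed.

Lemma rng_mul0r a : a ** 0 = 0.
Proof. by apply: (addrI (a ** 0)); rewrite -rng_mulDr !addr0. Qed.

Lemma rng_mulNl a b : (- a) ** b = - (a ** b).
Proof. by apply: (addrI (a ** b)); rewrite -rng_mulDl !subrr rng_mul0l. Qed.

Lemma rng_mulNr a b : a ** (- b) = - (a ** b).
Proof. by apply: (addrI (a ** b)); rewrite -rng_mulDr !subrr rng_mul0r. Qed.

Lemma rng_mulBl a b c : (a - b) ** c = a ** c - b ** c.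
Proof. by rewrite rng_mulDl rng_mulNl. Qed.

Lemma rng_mulBr a b c : c ** (a - b) = c ** a - c ** b.
Proof. by rewrite rng_mulDr rng_mulNr. Qed.

Lemma commuteDl a b x : commute a x -> commute b x -> commute (a + b) x.
Proof. by rewrite /commute rng_mulDl rng_mulDr => -> ->. Qed.

Lemma commuteNl a x : commute a x -> commute (- a) x.
Proof. by rewrite /commute rng_mulNl rng_mulNr => ->. Qed.

Lemma commuteBl a b x : commute a x -> commute b x -> commute (a - b) x.
Proof. by move=> ax /commuteNl; apply: commuteDl. Qed.

Lemma centralD a b : central a -> central b -> central (a + b).
Proof. by move=> ca cb x; apply: commuteDl. Qed.

Lemma centralN a : central a -> central (- a).
Proof. by move=> ca x; apply: commuteNl. Qed.

Lemma centralB a b : central a -> central b -> central (a - b).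
Proof. by move=> ca cb x; apply: commuteBl. Qed.

Lemma centralM a b : central a -> central b -> central (a ** b).
Proof. by move=> ca cb x; rewrite /commute -mulgA cb !mulgA ca. Qed.

Section Prime.
Hypothesis R_torsion_free : two_torsion_free R.
Hypothesis R_prime : prime_rng R.

Lemma commute_half a x : commute (a *+ 2) x -> commute a x.
Proof.
move=> ax; apply/eqP; rewrite -subr_eq0; apply/eqP/R_torsion_free.
move: ax; rewrite /commute !mulr2n rng_mulDl rng_mulDr => ax.
by rewrite addrACA -opprD ax subrr.
Qed.

Lemma central_half a : central (a *+ 2) -> central a.
Proof. by move=> ca x; apply: commute_half. Qed.

Lemma central_mul_eq0 c a : central c -> c ** a = 0 -> c = 0 \/ a = 0.
Proof.
by move=> cc ca; apply: R_prime => x; rewrite cc -mulgA ca rng_mul0r.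
Qed.

Lemma central_mulI c a b : central c -> c <> 0 -> c ** a = c ** b -> a = b.
Proof.
move=> cc c0 cab; have /(central_mul_eq0 cc) : c ** (a - b) = 0.
  by rewrite rng_mulBr cab subrr.
by case=> // /subr0_eq.
Qed.

Lemma central_cancel c a : central c -> c <> 0 -> central (c ** a) -> central a.
Proof.
move=> cc c0 ca x; apply: (central_mulI cc c0).
by rewrite mulgA ca !mulgA cc.
Qed.

(** * Maps congruent to the identity modulo the center *)

Section Noncommutative.
Variables x0 y0 : R.
Hypothesis x0y0 : x0 ** y0 <> y0 ** x0.

Lemma central_mul_noncommutative m :
  central m -> (forall y, central (m ** y)) -> m = 0.
Proof.
move=> cm my; apply/eqP/negPn/negP => /eqP m0; apply: x0y0.
exact: (central_cancel cm m0 (my x0)).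
Qed.

(** A nonzero deviation [f x - x] could be cancelled from the commutation hypothesis, making [x]
    central; so [f] fixes noncentral elements. A central [x] is the difference of the noncentral
    [x + x0] and [x0]. *)
Lemma deviation_eq0 (f : R -> R) :
    {morph f : x y / x + y} -> (forall x, central (f x - x)) ->
    (forall x y, commute ((f x - x) ** y) x) ->
  f =1 id.
Proof.
move=> fD fc fx.
have dev0 x : ~ central x -> f x = x.
  move=> ncx; apply/subr0_eq/eqP/negPn/negP => /eqP d0; apply: ncx => y.
  apply: (central_mulI (fc x) d0).
  by rewrite mulgA [RHS]mulgA fx fc mulgA.
have ncx0 : ~ central x0 by move/(_ y0)/x0y0.
move=> x; apply/eqP/negPn/negP => /eqP fxx; apply: (fxx).
apply: (dev0 x) => cx; apply: fxx.
have: f (x + x0) = x + x0.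
  apply: (dev0 (x + x0)) => cxx0; apply: ncx0.
  by rewrite -[x0](addKr x) addrC; apply: centralB.
by rewrite fD (dev0 x0) // => /addIr.
Qed.

Lemma quasi_identity (f : R -> R) :
    {morph f : x y / x + y} -> {morph f : x y / x ** y} ->
    (forall x, central (f x - x)) ->
  f =1 id.
Proof.
move=> fD fM fc; apply: deviation_eq0 => // x y.
have [a ca fxE] : exists2 a, central a & f x = a + x.
  by exists (f x - x); rewrite ?subrK.
have [b cb fyE] : exists2 b, central b & f y = b + y.
  by exists (f y - y); rewrite ?subrK.
rewrite fxE addrK.
have -> : a ** y = (f (x ** y) - x ** y) - a ** b - x ** b.
  by rewrite fM fxE fyE !rng_mulDl !rng_mulDr; zmod.
apply: commuteBl; last by rewrite /commute -mulgA cb mulgA.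
by apply: commuteBl; [apply: fc | apply: centralM].
Qed.

(** The symmetric sum [x ** y + y ** x] hides the reversal of factors, at the price of a factor 2.
    Once [f] is the identity, reversal contradicts [x0y0]. *)
Lemma quasi_identity_anti (f : R -> R) :
    {morph f : x y / x + y} -> (forall x y, f (x ** y) = f y ** f x) ->
    (forall x, central (f x - x)) ->
  False.
Proof.
move=> fD fM fc; suff fid : f =1 id.
  by apply: x0y0; rewrite -(fid (x0 ** y0)) fM !fid.
apply: deviation_eq0 => // x y; apply: commute_half.
have [a ca fxE] : exists2 a, central a & f x = a + x.
  by exists (f x - x); rewrite ?subrK.
have [b cb fyE] : exists2 b, central b & f y = b + y.
  by exists (f y - y); rewrite ?subrK.
rewrite fxE addrK.
have aE z : z ** a = a ** z by rewrite ca.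
have -> : (a ** y) *+ 2 = (f (x ** y) - x ** y) + (f (y ** x) - y ** x)
    - (a ** b) *+ 2 - (x ** b) *+ 2.
  by rewrite !fM fxE fyE !rng_mulDl !rng_mulDr !cb !aE; zmod.
rewrite !mulr2n.
have xb : commute (x ** b) x by rewrite /commute -mulgA cb mulgA.
have ab : commute (a ** b) x by apply: centralM.
by do !(apply: fc || apply: commuteBl || apply: commuteDl).
Qed.

(** * The polarised condition at a skew central element *)

Lemma skew_condition_contradiction (star g1 g2 : R -> R) (k : R) :
    rng_involution star -> rng_endomorphism g1 -> nontrivial_endomorphism g2 ->
    central k -> k <> 0 -> star k = - k ->
    (forall y,
      central (g1 k ** g2 y - g1 (star y) ** g2 k - k ** (y - star y))) ->
  False.
Proof.
case=> -[starD starM _] starK [g1D g1M] [[g2D g2M] g2id] ck k0 stark.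
set p := g1 k; set q := g2 k => D.
have g1N := additive_opp g1D.
have starky y : star (k ** y) = - (k ** star y).
  by rewrite starM stark rng_mulNr ck.
have vk y : g1 (star (k ** y)) = - (g1 (star y) ** p).
  by rewrite starky g1N -g1M ck g1M.
have pv x : p ** g1 x = g1 x ** p by rewrite -!g1M ck.
have qu x : q ** g2 x = g2 x ** q by rewrite -!g2M ck.
have kC a : a ** k = k ** a by rewrite ck.
have kCA a b : a ** (k ** b) = k ** (a ** b) by rewrite mulgA kC mulgA.
set c := p ** q.
have cc : central c.
  apply: central_half; have := D k; rewrite stark g1N -/p -/q opprK.
  rewrite rng_mulNl opprK rng_mulDr => ckk.
  have -> : c *+ 2 = (c + c - (k ** k + k ** k)) + (k ** k + k ** k).
    by rewrite mulr2n subrK.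
  by apply: centralD => //; apply: centralD; apply: centralM.
have cCA a b : a ** (c ** b) = c ** (a ** b).
  by rewrite mulgA -cc mulgA.
have C y : central (c ** (g2 y + g1 (star y)) - k ** (k ** (y + star y))).
  have := D (k ** y); rewrite vk starky g2M -/q.
  rewrite !opprK rng_mulNl opprK mulgA -/c -[_ ** p ** q]mulgA -/c -[_ ** c]cc.
  by rewrite -!rng_mulDr.
have noncentral : ~ (forall y, central y) by move=> /(_ x0 y0).
have c0 : c <> 0.
  move=> c0; apply: noncentral => y.
  have E z : central (z + star z).
    have := C z; rewrite c0 rng_mul0l sub0r => /centralN; rewrite opprK.
    by move=> /(central_cancel ck k0) /(central_cancel ck k0).
  (* As [star] negates [k], passing from [y] to [k ** y] exchanges [y + star y] and [y - star y] up
     to the factor [k]. *)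
  have := E (k ** y); rewrite starky -rng_mulBr => /(central_cancel ck k0) F.
  apply: central_half; have -> : y *+ 2 = (y + star y) + (y - star y) by zmod.
  exact: centralD.
have [z cz qE] : exists2 z, central z & q = p + z.
  exists (q - p); last by rewrite addrC subrK.
  (* At [k] the term in [k + star k] vanishes, leaving [c ** (q - p)]. *)
  apply: (central_cancel cc c0); have := C k.
  by rewrite stark g1N -/p -/q subrr !rng_mul0r subr0.
have [e ce eE] : exists2 e, central e & k ** k = c + e.
  exists (k ** k - c); last by rewrite addrC subrK.
  by apply: centralB => //; apply: centralM.
(* Since [z] is [q - p], combining [C (k ** y)], [c ** D y] and [z ** C y]
   eliminates [g2 y] and [g1 (star y)]. *)
have E y : central (z ** (k ** (y + star y)) - e ** (y - star y)).
  apply: (central_cancel ck k0).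
  have := C (k ** y); rewrite vk starky g2M -/q.
  have := D y; have := C y.
  set u := g2 y; set v := g1 (star y); set s := star y => Cy Dy Cky.
  have -> : k ** (z ** (k ** (y + s)) - e ** (y - s)) =
      (c ** (q ** u - v ** p) - k ** (k ** (k ** y - k ** s)))
    - c ** (p ** u - v ** q - k ** (y - s))
    - z ** (c ** (u + v) - k ** (k ** (y + s))).
    have ke w : k ** (k ** (k ** w)) = c ** (k ** w) + k ** (e ** w).
      by rewrite mulgA eE rng_mulDl (kCA e).
    rewrite qE !(rng_mulDr, rng_mulBr, rng_mulNr).
    rewrite !(rng_mulDl, rng_mulBl, rng_mulNl).
    rewrite !(rng_mulDr, rng_mulBr, rng_mulNr) !ke -/v -(pv (star y)) -/v.
    by rewrite -!cz !(kCA z) !(cCA z); zmod.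
  apply: centralB; [apply: centralB => //|]; exact: centralM.
have E' y : central (z ** (k ** (y - star y)) - e ** (y + star y)).
  apply: (central_cancel ck k0); have := E (k ** y).
  by rewrite starky opprK -rng_mulBr -rng_mulDr (kCA z) (kCA e) -rng_mulBr.
have zke : z ** k = e.
  apply/subr0_eq/central_mul_noncommutative.
    by apply: centralB => //; apply: centralM.
  move=> y; apply: central_half.
  have -> : ((z ** k - e) ** y) *+ 2 =
      (z ** (k ** (y + star y)) - e ** (y - star y))
      + (z ** (k ** (y - star y)) - e ** (y + star y)).
    by rewrite !(rng_mulDr, rng_mulBr, rng_mulNr) rng_mulBl -!mulgA; zmod.
  exact: centralD.
have e0 : e = 0.
  apply/R_torsion_free/central_mul_noncommutative.
    by rewrite mulr2n; apply: centralD.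
  move=> y; apply: central_half; rewrite -[y]starK; set s := star y.
  (* With [z ** k = e], this difference is four times [e ** y]. *)
  have := centralB (E s) (E' s).
  rewrite !mulgA zke !(rng_mulDr, rng_mulBr, rng_mulNr) !mulr2n rng_mulDl.
  by congr central; zmod.
have z0 : z = 0.
  by move: zke; rewrite e0 kC -[RHS](rng_mul0r k) => /(central_mulI ck k0).
have qp : q = p by rewrite qE z0 addr0.
have ckk : c = k ** k by rewrite eE e0 addr0.
have sum y : central (g2 y + g1 (star y) - (y + star y)).
  have := C y; rewrite ckk -mulgA -!rng_mulBr.
  by move=> /(central_cancel ck k0) /(central_cancel ck k0).
have cp : central p.
  have F y : commute (y + star y) p.
    have -> : y + star y =
        g2 y + g1 (star y) - (g2 y + g1 (star y) - (y + star y)).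
      by zmod.
    apply: commuteBl (sum y p); apply: commuteDl; last by rewrite /commute pv.
    by rewrite /commute -qp qu.
  have G y : commute (y - star y) p.
    apply: (central_mulI ck k0); have := F (k ** y).
    by rewrite starky -rng_mulBr /commute -!mulgA kCA.
  move=> y; apply/commute_sym/commute_half.
  have -> : y *+ 2 = (y + star y) + (y - star y) by zmod.
  exact: commuteDl.
(* The product [(p - k) ** (p + k)] is [c - k ** k], since [q = p]. *)
have [/subr0_eq pk|/eqP] : p - k = 0 \/ p + k = 0.
  apply: central_mul_eq0; first exact: centralB.
  by rewrite rng_mulBl !rng_mulDr kC -{2}qp -/c ckk; zmod.
- apply/g2id/quasi_identity => // y; apply: central_half.
  have -> : (g2 y - y) *+ 2 = (g2 y + g1 (star y) - (y + star y))
      + (g2 y - g1 (star y) - (y - star y)) by zmod.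
  apply: centralD => //; apply: (central_cancel ck k0).
  by have := D y; rewrite qp pk kC -!rng_mulBr.
- rewrite addr_eq0 => /eqP pk.
  apply: (quasi_identity_anti (f := g2 \o star)) => [x y|x y|x] /=.
  + by rewrite starD g2D.
  + by rewrite starM g2M.
  apply: central_half; rewrite -{2}(starK x); set y := star x.
  have -> : (g2 y - star y) *+ 2 = (g2 y + g1 (star y) - (y + star y))
      + (g2 y - g1 (star y) + (y - star y)) by zmod.
  apply: centralD => //; apply: (central_cancel ck k0).
  have := centralN (D y); rewrite qp pk !rng_mulNl !rng_mulNr kC.
  by rewrite !(rng_mulDr, rng_mulNr); congr central; zmod.
Qed.

End Noncommutative.
End Prime.
End Rng.

Theorem theorem2p6 (R : rngType) (star : R -> R) (g1 g2 : R -> R)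
  (R_torsion_free : two_torsion_free R)
  (R_prime : prime_rng R)
  (star_involution : rng_involution star)
  (star_second_kind : second_kind star)
  (g1_nontrivial : nontrivial_endomorphism g1)
  (g2_nontrivial : nontrivial_endomorphism g2)
  (g1g2_condition :
     (forall x : R, central (g1 x ** g2 (star x) - x ** star x)) \/
     (forall x : R, central (g1 x ** g2 (star x) - star x ** x))) :
  forall x y : R, x ** y = y ** x.
Proof.
move=> x0 y0; apply/eqP/negPn/negP => /eqP x0y0.
apply: star_second_kind => z cz; apply/eqP/negPn/negP => /eqP starz.
have [[starD starM _] starK] := star_involution.
have [g1_endo _] := g1_nontrivial; have [g1D _] := g1_endo.
have [[g2D _] _] := g2_nontrivial.
have starN := additive_opp starD; have g2N := additive_opp g2D.
(* An anti-automorphism preserves the center, so the skew part of the non-hermitian [z] is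
   central. *)
have [k [ck k0 stark]] : exists k, [/\ central k, k <> 0 & star k = - k].
  exists (z - star z); split.
  - by apply: centralB => // x; rewrite -(starK x) /commute -!starM cz.
  - by move/subr0_eq => zE; apply: starz.
  - by rewrite starD starN starK opprB.
suff H x : central (g1 k ** g2 (star x) - g1 x ** g2 k - k ** (star x - x)).
  apply: (skew_condition_contradiction R_torsion_free R_prime x0y0
    star_involution g1_endo g2_nontrivial ck k0 stark) => y.
  by have := H (star y); rewrite starK.
(* Polarising at [k] and [x] leaves the cross terms; as [k] is central and skew, both conditions
   give [k ** (star x - x)]. *)
case: g1g2_condition => g1g2;
  have := centralB (centralB (g1g2 (k + x)) (g1g2 k)) (g1g2 x);
  rewrite !g1D !starD !g2D stark g2N;
  rewrite !(rng_mulDl, rng_mulDr, rng_mulNl, rng_mulNr);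
  by rewrite -?(ck x) -?(ck (star x)); congr central; zmod.
Qed.
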